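(* Let $(\mathcal M,[\,,\,],\langle\,,\,\rangle)$ be a flat Lorentzian solvable Malcev algebra such that its center $Z(\mathcal M)$ is degenerate. Then $(\mathcal M,[\,,\,],\langle\,,\,\rangle)$ is a flat double extension of a Euclidean Lie algebra $(\overline{\mathcal M},[\,,\,]_{\overline{\mathcal M}},\langle\,,\,\rangle_{\overline{\mathcal M}})$ by means of $(D,\xi,b_0,0)$, for some $D,\xi\in\mathrm{End}(\overline{\mathcal M})$ and $b_0\in\overline{\mathcal M}$, where $(\overline{\mathcal M},[\,,\,]_{\overline{\mathcal M}},\langle\,,\,\rangle_{\overline{\mathcal M}})$ is flat as a Lie algebra ($K_0=0$).
   Context: All vector spaces are finite dimensional; here the base field is $\mathbb K=\mathbb R$. A Malcev algebra is a vector space with an anti-symmetric bilinear bracket satisfying $J(u,v,[u,w])=[J(u,v,w),u]$, where $J(u,v,w)=[[u,v],w]+[[w,u],v]+[[v,w],u]$. A pseudo-Euclidean Malcev (or Lie) algebra is one with a non-degenerate symmetric bilinear form; it is Euclidean if the form is positive definite (the zero space being allowed), Lorentzian if the form has signature $(1,n-1)$ (one minus sign). The Levi-Civita product $\bullet$ is defined by $2\langle u\bullet v,w\rangle=\langle[u,v],w\rangle-\langle[v,w],u\rangle+\langle[w,u],v\rangle$; $\mathrm L_u(v)=u\bullet v$. A pseudo-Euclidean Malcev algebra is flat if $K=0$, where $$K(u,v,w)=\mathrm L_{[[u,v],w]}-\mathrm L_{[u,w]}\circ\mathrm L_v-\mathrm L_u\circ\mathrm L_{[v,w]}+\mathrm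 L_v\circ\mathrm L_u\circ\mathrm L_w-\mathrm L_w\circ\mathrm L_v\circ\mathrm L_u.$$ A pseudo-Euclidean Lie algebra is flat as a Lie algebra if $K_0(u,v)=\mathrm L_{[u,v]}-[\mathrm L_u,\mathrm L_v]=0$ for all $u,v$. The center is $Z(\mathcal M)=\{u:[u,v]=0\ \forall v\in\mathcal M\}$; it is degenerate if $Z(\mathcal M)\cap Z(\mathcal M)^\perp\neq\{0\}$. Flat double extension: let $(\overline{\mathcal M},[\,,\,]_{\overline{\mathcal M}},\langle\,,\,\rangle_{\overline{\mathcal M}})$ be a flat pseudo-Euclidean Malcev algebra with Levi-Civita product $\bullet_{\overline{\mathcal M}}$, $D,\xi\in\mathrm{End}(\overline{\mathcal M})$, $b_0\in\overline{\mathcal M}$, $\lambda\in\mathbb K$. A flat pseudo-Euclidean Malcev algebra is a flat double extension of $\overline{\mathcal M}$ by means of $(D,\xi,b_0,\lambda)$ if it is isometrically isomorphic to $\mathbb Kd\oplus\overline{\mathcal M}\oplus\mathbb Ke$ with the bracket $$[d,e]=\lambda e,\quad [d,u]=D(u)+\langle b_0,u\rangle_{\overline{\mathcal M}}e,\quad [e,u]=0,\quad [u,v]=[u,v]_{\overline{\mathcal M}}-\langle(\xi-\xi^* )(u),v\rangle_{\overline{\mathcal M}}e,$$ the form extending $\langle\,,\,\rangle_{\overline{\mathcal M}}$ with $\langle e,d\rangle=1$, $\langle d,d\rangle=\langle e,e\rangle=0$, $\langle d,\overline{\mathcal M}\rangle=\langle e,\overline{\mathcal M}\rangle=0$, and whose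 Levi-Civita product is $e\bullet e=e\bullet u=u\bullet e=e\bullet d=0$, $d\bullet e=\lambda e$, $d\bullet u=(D+\xi)(u)+\langle b_0,u\rangle_{\overline{\mathcal M}}e$, $u\bullet d=\xi(u)$, $d\bullet d=-b_0-\lambda d$, $u\bullet v=u\bullet_{\overline{\mathcal M}}v-\langle\xi(u),v\rangle_{\overline{\mathcal M}}e$, for $u,v\in\overline{\mathcal M}$ ($\xi^*$ is the adjoint of $\xi$). *)

(* Defs.v *)
From HB Require Import structures.
From mathcomp Require Import all_boot all_order all_algebra.
From mathcomp Require Import ring.
From mathcomp Require Import boolp classical_sets reals.

Set Implicit Arguments.
Unset Strict Implicit.
Unset Printing Implicit Defensive.

Import Order.TTheory GRing.Theory Num.Theory.
Local Open Scope ring_scope.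

Section Brackets.
Context {R : realType} {V : vectType R}.
Variable br : {bilinear V -> V -> V}.

Definition antisymmetric_bracket : Prop := forall u v, br u v = - br v u.

Definition jacobiator (u v w : V) : V :=
  br (br u v) w + br (br w u) v + br (br v w) u.

Definition malcev_algebra : Prop :=
  antisymmetric_bracket /\
  (forall u v w, jacobiator u v (br u w) = br (jacobiator u v w) u).

Definition lie_algebra : Prop :=
  antisymmetric_bracket /\ (forall u v w, jacobiator u v w = 0).

(* The kernel of u |-> [u, -]; see centerP. *)
Definition center : {vspace V} := lker (linfun (fun u => linfun (br u))).

Lemma centerP u : reflect (forall v, br u v = 0) (u \in center).
Proof.
have lin : linear (fun u => linfun (br u)).
  move=> a x y; apply/lfunP => z.
  by rewrite lfunE /= linearDl linearZl_LR add_lfunE scale_lfunE !lfunE.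
pose adl := GRing.isLinear.Build _ _ _ _ (fun u => linfun (br u)) lin.
pose ad : {linear V -> 'End(V)} := HB.pack (fun u => linfun (br u)) adl.
have -> : center = lker (linfun ad) by exact: erefl.
rewrite memv_ker lfunE /=; apply: (iffP eqP) => [h v|h].
  by rewrite -[LHS](lfunE (br u)) h lfunE.
by apply/lfunP => v; rewrite !lfunE /= h.
Qed.

(* [U, U], the span of all brackets; by bilinearity a basis suffices. *)
Definition derived (U : {vspace V}) : {vspace V} :=
  <<[seq br u v | u <- vbasis U, v <- vbasis U]>>%VS.

Lemma mem_derived (U : {vspace V}) u v :
  u \in U -> v \in U -> br u v \in derived U.
Proof.
move=> /coord_vbasis -> /coord_vbasis ->.
rewrite linear_sumlz memv_suml // => i _.
rewrite linear_sumr memv_suml // => j _.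
rewrite linearZlr /= !memvZ // memv_span //.
by apply: allpairs_f; rewrite mem_nth // size_tuple.
Qed.

Definition solvable_algebra : Prop := exists k, iter k derived fullv = 0%VS.

End Brackets.

Section Forms.
Context {R : realType} {V : vectType R}.
Variable B : {symmetric V}.

Definition euclidean : Prop := forall u, u != 0 -> 0 < B u u.

(* Signature (p, q): p minus signs and q plus signs. *)
Definition has_signature (p q : nat) : Prop :=
  exists X : (p + q).-tuple V, basis_of fullv X /\
    forall i j : 'I_(p + q), B (tnth X i) (tnth X j) =
      if i == j then (if (i < p)%N then -1 else 1) else 0.

Definition lorentzian : Prop := has_signature 1 (\dim {:V}).-1.

Definition adjoint (f : 'End(V)) : 'End(V) :=
  xget 0 [set g : 'End(V) | forall u v, B (g u) v = B u (f v)]%classic.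

Lemma rieszP (phi : {scalar V}) :
  nondegenerate B -> exists x, forall w, B x w = phi w.
Proof.
move=> ndB.
have lin : linear (fun u => linfun (B u : V -> R^o)).
  move=> a x y; apply/lfunP => z.
  by rewrite lfunE /= linearDl linearZl_LR add_lfunE scale_lfunE !lfunE.
pose fl := GRing.isLinear.Build _ _ _ _ (fun u => linfun (B u : V -> R^o)) lin.
pose flat : {linear V -> 'Hom(V, R^o)} :=
  HB.pack (fun u => linfun (B u : V -> R^o)) fl.
have kf : lker (linfun flat) == 0%VS.
  rewrite -subv0; apply/subvP => x; rewrite memv_ker lfunE /= => /eqP h.
  rewrite -(eqP ndB); apply/mem_orthovP => v _.
  have : linfun (B x : V -> R^o) v = 0 by rewrite h lfunE.
  by rewrite lfunE.
have sf : limg (linfun flat) = fullv.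
  apply/eqP; rewrite eqEdim subvf /= limg_dim_eq; last by rewrite (eqP kf) capv0.
  by rewrite !dimvf /dim /= muln1.
have : linfun (phi : V -> R^o) \in limg (linfun flat) by rewrite sf memvf.
case/memv_imgP => x _; rewrite lfunE /= => h; exists x => w.
by have /= := congr1 (fun f : 'Hom(V, R^o) => f w) h; rewrite !lfunE.
Qed.

Lemma nondegenerate_inj x y :
  nondegenerate B -> (forall w, B x w = B y w) -> x = y.
Proof.
move=> ndB h; apply/eqP; rewrite -subr_eq0 -memv0 -(eqP ndB).
by apply/mem_orthovP => v _; rewrite linearBl /= h subrr.
Qed.

End Forms.

Section MetricAlgebras.
Context {R : realType} {V : vectType R}.
Variables (br : {bilinear V -> V -> V}) (B : {symmetric V}).

(* The Koszul formula determines the product when the form is nondegenerate;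
   see levi_civitaP and levi_civita_unique. *)
Definition levi_civita (u v : V) : V :=
  xget 0 [set x | forall w,
    2 * B x w = B (br u v) w - B (br v w) u + B (br w u) v]%classic.

Definition lmul (u : V) : 'End(V) := linfun (levi_civita u).

Definition malcev_curvature (u v w : V) : 'End(V) :=
  lmul (br (br u v) w) - (lmul (br u w) \o lmul v)%VF
  - (lmul u \o lmul (br v w))%VF
  + (lmul v \o lmul u \o lmul w)%VF - (lmul w \o lmul v \o lmul u)%VF.

Definition lie_curvature (u v : V) : 'End(V) :=
  lmul (br u v) - ((lmul u \o lmul v)%VF - (lmul v \o lmul u)%VF).

Definition lie_flat : Prop := forall u v, lie_curvature u v = 0.

Definition flat_pseudo_euclidean_malcev : Prop :=
  [/\ malcev_algebra br, nondegenerate B &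
      forall u v w, malcev_curvature u v w = 0].

Definition degenerate_center : Prop :=
  (center br :&: orthov B (center br))%VS != 0%VS.

Hypothesis ndB : nondegenerate B.

Lemma levi_civitaP u v w :
  2 * B (levi_civita u v) w = B (br u v) w - B (br v w) u + B (br w u) v.
Proof.
pose phi0 w := 2^-1 * (B (br u v) w - B (br v w) u + B (br w u) v).
have lin : scalar phi0.
  move=> a x y; rewrite /phi0 !(linearDr, linearDl, linearZr_LR, linearZl_LR) /=.
  by ring.
pose phil := GRing.isLinear.Build _ _ _ _ phi0 lin.
pose phi : {scalar V} := HB.pack phi0 phil.
have [x xP] := rieszP phi ndB.
suff : exists x, [set x | forall w, 2 * B x w =
    B (br u v) w - B (br v w) u + B (br w u) v]%classic x.
  by move/(xgetPex 0); apply.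
by exists x => z /=; rewrite xP /= /phi0 mulrA divff ?mul1r // pnatr_eq0.
Qed.

Lemma levi_civita_unique u v x :
  (forall w, 2 * B x w = B (br u v) w - B (br v w) u + B (br w u) v) ->
  levi_civita u v = x.
Proof.
move=> xP; apply: (nondegenerate_inj ndB) => w.
by apply: (@mulfI _ 2); rewrite ?pnatr_eq0 // levi_civitaP xP.
Qed.

Lemma lmulE u v : lmul u v = levi_civita u v.
Proof.
have lin : linear (levi_civita u).
  move=> a x y; apply: levi_civita_unique => w.
  rewrite linearDl linearZl_LR /= mulrDr mulrCA !levi_civitaP.
  rewrite !(linearDr, linearDl, linearZr_LR, linearZl_LR) /=.
  by ring.
pose lcl := GRing.isLinear.Build _ _ _ _ (levi_civita u) lin.
pose lc : {linear V -> V} := HB.pack (levi_civita u) lcl.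
exact: (lfunE lc v).
Qed.

Lemma adjointP (f : 'End(V)) u v : B (adjoint B f u) v = B u (f v).
Proof.
suff : exists g : 'End(V),
    [set g : 'End(V) | forall u v, B (g u) v = B u (f v)]%classic g.
  by move/(xgetPex 0); apply.
have /choice[g0 g0P] x : exists y, forall w, B y w = B x (f w).
  have lin : scalar (B x \o f) by move=> a y z /=; rewrite !linearP.
  pose phil := GRing.isLinear.Build _ _ _ _ (B x \o f) lin.
  pose phi : {scalar V} := HB.pack (B x \o f) phil.
  exact: (rieszP phi ndB).
have lin : linear g0.
  move=> a x y; apply: (nondegenerate_inj ndB) => w.
  by rewrite linearDl linearZl_LR /= !g0P linearDl linearZl_LR.
pose gl := GRing.isLinear.Build _ _ _ _ g0 lin.
pose g : {linear V -> V} := HB.pack g0 gl.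
by exists (linfun g) => x w; rewrite (lfunE g) /= g0P.
Qed.

End MetricAlgebras.

Definition isometrically_isomorphic {R : realType} {V W : vectType R}
    (brV : {bilinear V -> V -> V}) (BV : {symmetric V})
    (brW : {bilinear W -> W -> W}) (BW : {symmetric W}) : Prop :=
  exists f : {linear V -> W},
    [/\ bijective f, (forall u v, f (brV u v) = brW (f u) (f v)) &
        isometry BW BV f].

(* An element (a, u, b) of R^o * V * R^o stands for a d + u + b e. *)
Section DoubleExtension.
Context {R : realType} {V : vectType R}.
Variables (br : {bilinear V -> V -> V}) (B : {symmetric V}).
Variables (D xi : 'End(V)) (b0 : V) (lambda : R).

Local Notation E := (R^o * V * R^o)%type.

Definition dext_bracket (x y : E) : E :=
  let: (a, u, b) := x in let: (a', u', b') := y in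
  (0,
   a *: D u' - a' *: D u + br u u',
   lambda * (a * b' - a' * b) + a * B b0 u' - a' * B b0 u
     - B ((xi - adjoint B xi) u) u').

Definition dext_form (x y : E) : R :=
  let: (a, u, b) := x in let: (a', u', b') := y in
  a * b' + b * a' + B u u'.

Definition dext_product (x y : E) : E :=
  let: (a, u, b) := x in let: (a', u', b') := y in
  (- (lambda * (a * a')),
   a *: (D + xi) u' + a' *: xi u - (a * a') *: b0 + levi_civita br B u u',
   lambda * (a * b') + a * B b0 u' - B (xi u) u').

Lemma dext_bracket_bilinear : bilinear_for *:%R *:%R dext_bracket.
Proof.
have sumE (W : zmodType) (x1 x2 y1 y2 z1 z2 : W) :
    x1 + x2 - (y1 + y2) + (z1 + z2) = x1 - y1 + z1 + (x2 - y2 + z2).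
  by rewrite opprD (addrACA x1 x2) (addrACA (x1 - y1)).
split=> [[[a u] b]|[[a u] b]] c [[a1 u1] b1] [[a2 u2] b2] /=.
  congr (_, _, _).
  - by rewrite [RHS]/= /GRing.scale /= mulr0 addr0.
  - rewrite linearP linearDl linearZl_LR /= scalerDl [a *: _]scalerDr sumE.
    by rewrite scalerDr scalerBr !scalerA [c * a]mulrC.
  - rewrite (linearDr B b0) (linearZr_LR B b0) linearP (linearDl B) (linearZl_LR B) /=.
    by rewrite /GRing.scale /=; ring.
congr (_, _, _).
- by rewrite [RHS]/= /GRing.scale /= mulr0 addr0.
- rewrite linearP linearDr linearZr_LR /= scalerDl [a *: _]scalerDr sumE.
  by rewrite scalerDr scalerBr !scalerA [c * a]mulrC.
- rewrite !linearDr !linearZr_LR /=.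
  by rewrite /GRing.scale /=; ring.
Qed.

HB.instance Definition _ :=
  bilinear_isBilinear.Build R E E E *:%R *:%R dext_bracket
    dext_bracket_bilinear.

Lemma dext_form_bilinear : bilinear_for *%R (idfun \; *%R) dext_form.
Proof.
split=> [[[a u] b]|[[a u] b]] c [[a1 u1] b1] [[a2 u2] b2] /=.
  by rewrite linearDl linearZl_LR /GRing.scale /=; ring.
by rewrite linearDr linearZr_LR /GRing.scale /=; ring.
Qed.

HB.instance Definition _ :=
  bilinear_isBilinear.Build R E E R *%R (idfun \; *%R) dext_form
    dext_form_bilinear.

Lemma dext_form_symmetric x y :
  dext_form x y = (-1) ^+ false * idfun (dext_form y x).
Proof.
case: x y => [[a u] b] [[a' u'] b'] /=.
rewrite (hermitian_subproof u u') /= !expr0 !mul1r; congr (_ + _).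
by rewrite addrC [a * b']mulrC [b * a']mulrC.
Qed.

HB.instance Definition _ :=
  isHermitianSesquilinear.Build R E false idfun dext_form dext_form_symmetric.

End DoubleExtension.

Definition flat_double_extension {R : realType} {V M : vectType R}
    (brV : {bilinear V -> V -> V}) (BV : {symmetric V})
    (D xi : 'End(V)) (b0 : V) (lambda : R)
    (brM : {bilinear M -> M -> M}) (BM : {symmetric M}) : Prop :=
  [/\ flat_pseudo_euclidean_malcev brV BV,
      flat_pseudo_euclidean_malcev brM BM,
      isometrically_isomorphic brM BM
        (dext_bracket brV BV D xi b0 lambda) (dext_form BV) &
      forall x y : (R^o * V * R^o)%type,
        levi_civita (dext_bracket brV BV D xi b0 lambda) (dext_form BV) x y
        = dext_product brV BV D xi b0 lambda x y].

(* Main.v *)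
Require Import Defs.
From HB Require Import structures.
From mathcomp Require Import all_boot all_order all_algebra.
From mathcomp Require Import ring lra.
From mathcomp Require Import boolp reals.

(** Write [u * v] for the Levi-Civita product of the Lorentzian algebra [M] and
    [e] for a nonzero null central vector, which a degenerate center provides.

    The first point is that [e * u = u * e = 0] for all [u]
    ([central_null_mul0]).  As [e] is central, [S = L_e] is also right
    multiplication by [e]; it is skew-symmetric and kills [e].  Flatness with
    [e] in two of its slots, or in one slot and as argument, gives
    [L_v S S = S L_v S = 0].  In Lorentzian signature a null vector orthogonal
    to [e] is a multiple of [e].  The vectors [S (S x)] are of this kind, so if
    one of them is nonzero then [L_v e = 0] for all [v]; otherwise the vectors
    [S x] are null and multiples of [e], and a skew-symmetric map of rank at
    most one is zero.

    Hence all products are orthogonal to [e], and the product of [M] descends to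
    the quotient of the orthogonal of [e] by [e].  Choosing a null [d] with
    [B e d = 1], this quotient is realized on the Euclidean subspace
    orthogonal to [e] and [d], the screen.  It is again a flat solvable Malcev
    algebra, now with a positive definite form.

    The second point is that for such a Euclidean algebra the curvature
    [P u v = L_[u, v] - (L_u L_v - L_v L_u)] vanishes
    ([euclidean_malcev_flat]); the Jacobi identity follows, since the cyclic sum
    of [P u v w] is the jacobiator.  Let [b] be nonzero and orthogonal to all
    brackets, [L] and [Q] the left and right multiplications by [b], so that [Q]
    is symmetric.  Flatness evaluated on [b] shows that the symmetric map
    [T = Q L - L Q - Q Q] satisfies [L T = T (L - Q) = 0], hence [T T = 0] and
    [T = 0]; then [Q Q] is a commutator, its trace is zero, and [Q = 0]
    ([rmul_orth_commutators]).  By induction the curvature is zero on the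
    hyperplane orthogonal to [b], and what remains are the maps [P b v] with [v]
    orthogonal to [b].  They anticommute with the left multiplications and kill
    the image of [L_v], which forces their squares to vanish
    ([curvature_eq0_codim1]).

    Finally [M] is the sum of the line of [d], the screen and the line of [e].
    In this decomposition [D], [xi] and [b0] are the screen parts of [d, u],
    of [u * d] and of [- d * d]; skew-symmetry of [L_d] says that [D + xi] is
    skew-symmetric, which is exactly what makes the Levi-Civita product of the
    double extension the prescribed one ([dext_levi_civita]). *)

Set Implicit Arguments.
Unset Strict Implicit.
Unset Printing Implicit Defensive.

Import Order.TTheory GRing.Theory Num.Theory.
Local Open Scope ring_scope.

(** * Linear identities through coordinates *)

Definition bilinE := (linearBl, linearDl, linearNl, linear0l,
  linearBr, linearDr, linearNr, linear0r, linearZl_LR, linearZr_LR).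

Section Coordinates.
Context {K : fieldType} {V : vectType K}.

Definition coordinate (i : 'I_(\dim {:V})) (x : V) : K := coord (vbasis {:V}) i x.

Lemma coordinate_inj x y : (forall i, coordinate i x = coordinate i y) -> x = y.
Proof.
move=> h; rewrite (coord_vbasis (memvf x)) (coord_vbasis (memvf y)).
by apply: eq_bigr => i _; congr (_ *: _); apply: h.
Qed.

Lemma coordinateD i x y : coordinate i (x + y) = coordinate i x + coordinate i y.
Proof. exact: linearD. Qed.

Lemma coordinateN i x : coordinate i (- x) = - coordinate i x.
Proof. exact: linearN. Qed.

Lemma coordinate0 i : coordinate i 0 = 0.
Proof. exact: linear0. Qed.

Lemma coordinateZ i a x : coordinate i (a *: x) = a * coordinate i x.
Proof. exact: linearZ. Qed.

Definition coordinateE := (coordinateD, coordinateN, coordinate0, coordinateZ).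

End Coordinates.

(** Decides identities that follow from the vector space axioms and from the
    bilinearity of the products involved: the ring tactic only knows
    commutative rings, so the identity is read coordinatewise. *)
Ltac vect_ring :=
  rewrite ?bilinE /=; apply: coordinate_inj => ?; rewrite ?coordinateE; ring.

(** * Euclidean forms *)

Section Forms.
Context {R : realType} {V : vectType R}.
Variable B : {symmetric V}.

Lemma symmetric_formC x y : B x y = B y x.
Proof. by rewrite (hermC B) expr0 mul1r. Qed.

Hypothesis eB : euclidean B.

Lemma euclidean_ge0 x : 0 <= B x x.
Proof.
have [->|/eB/ltW//] := eqVneq x 0; by rewrite linear0l.
Qed.

Lemma euclidean_eq0 x : B x x = 0 -> x = 0.
Proof. by move=> h; apply/eqP/negP => /negP/eB; rewrite h ltxx. Qed.

Lemma euclidean_nondegenerate : nondegenerate B.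
Proof.
rewrite /nondegenerate -subv0; apply/subvP => x /mem_orthovP h.
by rewrite memv0; apply/eqP/euclidean_eq0/h/memvf.
Qed.

(** A form of Gram-Schmidt: the expansion along the frame is all that computing
    a trace requires. *)
Lemma parseval_frame : exists s : seq V, forall x, x = \sum_(e <- s) B x e *: e.
Proof.
suff h n (U : {vspace V}) : \dim U = n -> exists2 s : seq V, {subset s <= U}
    & forall x, x \in U -> x = \sum_(e <- s) B x e *: e.
  by have [s _ sP] := h _ _ (erefl (\dim {:V})); exists s => x; apply: sP (memvf x).
elim: n U => [|n IHn] U dU.
  exists [::] => // x; move/eqP: dU; rewrite dimv_eq0 => /eqP ->.
  by rewrite memv0 big_nil => /eqP.
have Un0 : U != 0%VS by rewrite -dimv_eq0 dU.
pose w := vpick U; pose v := (Num.sqrt (B w w))^-1 *: w.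
have wn0 : w != 0 by rewrite vpick0.
have vU : v \in U by rewrite memvZ ?memv_pick.
have Bv : B v v = 1.
  rewrite /v linearZl_LR linearZr_LR /= mulrA -expr2 exprVn sqr_sqrtr ?euclidean_ge0 //.
  by rewrite mulVf // gt_eqF // eB.
have Uv : v \notin orthov B U.
  by apply/mem_orthovPn; exists v => //; rewrite Bv oner_eq0.
have dU' : \dim (U :&: orthov B <[v]>) = n by rewrite -eq_dim_orthov1 // dU.
have [s sU sP] := IHn _ dU'.
have sv e : e \in s -> B v e = 0.
  by move=> /sU; rewrite memv_cap mem_orthov1 symmetric_formC => /andP[_ /eqP].
exists (v :: s) => [e|x xU].
  by rewrite inE => /predU1P[-> //|/sU]; rewrite memv_cap => /andP[].
rewrite big_cons.
have x'U : x - B x v *: v \in (U :&: orthov B <[v]>)%VS.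
  rewrite memv_cap (memvB xU (memvZ _ vU)) /= mem_orthov1.
  by rewrite linearBl linearZl_LR /= Bv mulr1 subrr.
apply/eqP; rewrite -subr_eq0 opprD addrA subr_eq0; apply/eqP.
rewrite [LHS]sP // big_seq [RHS]big_seq; apply: eq_bigr => e /sv ve.
by rewrite linearBl linearZl_LR /= ve mulr0 subr0.
Qed.

(** The trace of [f f] is both a sum of squared norms and the trace of a
    commutator.  As [f] is symmetric and [g] skew-symmetric, the latter is twice
    the trace of [f g], whose terms cancel in pairs. *)
Lemma symmetric_square_commutator (f g : {linear V -> V}) :
  (forall x y, B (f x) y = B x (f y)) ->
  (forall x y, B (g x) y = - B x (g y)) ->
  (forall x, f (f x) = f (g x) - g (f x)) -> forall x, f x = 0.
Proof.
move=> fS gA fE.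
have [s sP] := parseval_frame.
pose a e e' := B (f e) e' * B (g e) e'.
have sqE e : B (f e) (f e) = \sum_(e' <- s) 2 * a e e'.
  have -> : B (f e) (f e) = 2 * B (f e) (g e).
    rewrite {1}fS fE linearBr /= -fS -[B e (g _)]opprK -gA [B (g e) _]symmetric_formC.
    by rewrite opprK mulr_natl mulr2n.
  rewrite {1}(sP (f e)) linear_sumlz /= big_distrr; apply: eq_bigr => e' _.
  by rewrite linearZl_LR /= /a [B e' _]symmetric_formC.
have aN e e' : a e e' = - a e' e.
  by rewrite /a fS gA [B e _]symmetric_formC [B e (g _)]symmetric_formC mulrN.
have s0 : \sum_(e <- s) B (f e) (f e) = 0.
  have e1 : \sum_(e <- s) B (f e) (f e) = - \sum_(e <- s) B (f e) (f e).
    rewrite {1}(eq_bigr _ (fun e _ => sqE e)) exchange_big /= -sumrN.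
    apply: eq_bigr => e _; rewrite sqE -sumrN; apply: eq_bigr => e' _.
    by rewrite aN mulrN.
  by lra.
have fs e : e \in s -> f e = 0.
  move=> es; apply: euclidean_eq0; apply/eqP.
  move: s0 => /eqP; rewrite psumr_eq0 => [/allP/(_ e es)//|i _].
  exact: euclidean_ge0.
move=> x; rewrite (sP x) linear_sum big_seq big1 //= => e /fs fe0.
by rewrite linearZ /= fe0 scaler0.
Qed.
End Forms.

(** * Flat products *)

Section SkewProducts.
Context {R : realType} {V : vectType R}.
Variables (p : {bilinear V -> V -> V}) (B : {symmetric V}).

Definition commutator u v := p u v - p v u.

(** The operator [P u v] that vanishes when the product is flat in the Lie sense. *)
Definition curvature u v x :=
  p (commutator u v) x - (p u (p v x) - p v (p u x)).

Definition skew_product := forall u x y, B (p u x) y = - B x (p u y).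

Definition malcev_flat_product := forall u v w x,
  p (commutator (commutator u v) w) x - p (commutator u w) (p v x)
  - p u (p (commutator v w) x) + p v (p u (p w x)) - p w (p v (p u x)) = 0.

Hypotheses (skew : skew_product) (flat : malcev_flat_product).

Lemma commutatorC u v : commutator u v = - commutator v u.
Proof. by rewrite /commutator opprB. Qed.

Lemma commutatorxx u : commutator u u = 0.
Proof. by rewrite /commutator subrr. Qed.

Lemma curvature_skew u v x y : B (curvature u v x) y = - B x (curvature u v y).
Proof.
rewrite /curvature !bilinE /= !skew; lra.
Qed.

Lemma curvatureN u v x : curvature u v x = - curvature v u x.
Proof.
by rewrite /curvature -[commutator u v]opprB linearNl /= !opprB addrC.
Qed.

Lemma curvatureDl u v w x :
  curvature (u + v) w x = curvature u w x + curvature v w x.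
Proof.
have cD : commutator (u + v) w = commutator u w + commutator v w.
  by rewrite /commutator linearDl linearDr opprD addrACA.
by rewrite /curvature cD; vect_ring.
Qed.

Lemma curvature_diag u x : curvature u u x = 0.
Proof. by rewrite /curvature /commutator !subrr linear0l subrr. Qed.

(** Flatness rewritten in terms of [P]: the terms free of [P] cancel, by an
    identity valid in every associative algebra of operators. *)
Lemma curvature_flat u v w x :
  curvature (commutator u v) w x + curvature u v (p w x) - p w (curvature u v x)
    - curvature u w (p v x) - p u (curvature v w x) = 0.
Proof. by rewrite -(flat u v w x) /curvature /commutator; vect_ring. Qed.

(** The case [u = v] of [curvature_flat]. *)
Lemma curvature_anticomm u w x : curvature u w (p u x) = - p u (curvature u w x).
Proof.
have := curvature_flat u u w x.
have -> : commutator u u = 0 by rewrite /commutator subrr.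
rewrite !curvature_diag linear0r [curvature 0 w x]curvatureN.
have -> : curvature w 0 x = 0 by rewrite /curvature /commutator; vect_ring.
by move=> /eqP; rewrite oppr0 !add0r subr_eq0 => /eqP <-; rewrite opprK.
Qed.

(** The symmetric operator [T = Q L - L Q - Q Q] built from the two
    multiplications by [b] is killed by [L] and by [L - Q], so its square is
    zero; a symmetric nilpotent operator of a Euclidean space is zero, and then
    [Q Q] is the commutator of [Q] and [L]. *)
Lemma rmul_orth_commutators b : euclidean B ->
  (forall u v, B b (commutator u v) = 0) -> forall u, p u b = 0.
Proof.
move=> eB bC.
have Rsym x y : B (p x b) y = B x (p y b).
  apply/eqP; rewrite -subr_eq0 [B x _]symmetric_formC !skew -opprD -linearBr /= .
  by rewrite -/(commutator y x) bC oppr0.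
have bb : p b b = 0.
  apply: (nondegenerate_inj (euclidean_nondegenerate eB)) => w.
  rewrite linear0l /= skew.
  have := bC b w; have := skew w b b.
  by rewrite [B (p w b) b]symmetric_formC /commutator linearBr /=; lra.
pose T x := p (commutator b x) b - p b (p x b).
(* flatness at the triple b, b, x, evaluated on b *)
have LT x : p b (T x) = 0.
  have := flat b b x b; rewrite commutatorxx bb /T [commutator 0 x]commutatorC.
  rewrite {1}/commutator !bilinE /= => /eqP.
  rewrite !(subr0, oppr0, sub0r) addrC subr_eq0 => /eqP ->.
  by rewrite subrr.
(* flatness at the triple b, x, b, evaluated on b *)
have TA x : T (commutator b x) = 0.
  have := flat b x b b; rewrite commutatorxx bb /T.
  rewrite [commutator (_ _ _) b]commutatorC [commutator x b]commutatorC.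
  rewrite !linearNl /= !linear0l !linear0r !linearNr /= => /eqP.
  by rewrite opprK addr0 !subr0 addrC subr_eq0 eq_sym -subr_eq0 => /eqP.
have Tsym x y : B (T x) y = B x (T y).
  rewrite /T /commutator !bilinE /= !(Rsym, skew); lra.
have TL x : T (p b x) = 0.
  apply: (nondegenerate_inj (euclidean_nondegenerate eB)) => w.
  by rewrite Tsym skew LT linear0r linear0l oppr0.
have TD x y : T (x - y) = T x - T y by rewrite /T /commutator; vect_ring.
have TR x : T (p x b) = 0.
  by have /eqP := TA x; rewrite /commutator TD TL sub0r oppr_eq0 => /eqP.
have T0 x : T x = 0.
  apply: (euclidean_eq0 eB); rewrite Tsym {2}/T TD TR TL subrr.
  exact: linear0r.
apply: (symmetric_square_commutator eB (f := applyr p b) (g := p b)) => //.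
  exact: skew.
move=> x; rewrite /=; have /eqP := T0 x; rewrite /T /commutator linearBl /=.
by rewrite subr_eq0 => /eqP <-; rewrite opprB addrC subrK.
Qed.

Lemma curvatureZl a u v x : curvature (a *: u) v x = a *: curvature u v x.
Proof. by rewrite /curvature /commutator; vect_ring. Qed.

Lemma curvatureDr u v x y : curvature u v (x + y) = curvature u v x + curvature u v y.
Proof. by rewrite /curvature; vect_ring. Qed.

Lemma curvatureNr u v x : curvature u v (- x) = - curvature u v x.
Proof. by rewrite /curvature; vect_ring. Qed.

(** For [v] orthogonal to [b], the operator [P b v] kills the image of [L_v],
    anticommutes with [L_b], and anticommutes with [L_h] for [h] orthogonal
    to [b].  Expanding one factor of its square leaves [P b v] composed with
    [L_[b, v]], a product of two anticommuting skew-symmetric operators; this is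
    skew-symmetric whereas a square is symmetric, so the square is zero. *)
Lemma curvature_eq0_codim1 b : euclidean B -> b != 0 -> (forall u, p u b = 0) ->
  (forall u v w, B b u = 0 -> B b v = 0 -> B b w = 0 -> curvature u v w = 0) ->
  forall u v x, curvature u v x = 0.
Proof.
move=> eB bn0 pb curvH.
have pH u v : B b (p u v) = 0.
  by rewrite symmetric_formC skew pb linear0r oppr0.
have cH u v : B b (commutator u v) = 0 by rewrite linearBr /= !pH subrr.
have decomp x : exists a, exists2 h, B b h = 0 & x = a *: b + h.
  exists (B b x / B b b), (x - (B b x / B b b) *: b); last by rewrite addrC subrK.
  by rewrite linearBr linearZr_LR /= divfK ?subrr // gt_eqF // eB.
have curvb u v : curvature u v b = 0.
  by rewrite /curvature !pb !linear0r !subrr.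
have curvHH h k x : B b h = 0 -> B b k = 0 -> curvature h k x = 0.
  move=> bh bk; have [a [w bw ->]] := decomp x.
  by rewrite curvatureDr -[a *: b]opprK (curvH h k w) // addr0 curvatureNr
    -scaleNr /curvature !linearZr_LR /= !pb !scaler0 !linear0r !subrr oppr0.
(* curvature_flat at the triple b, v, v *)
have LP v x : B b v = 0 -> p v (curvature b v x) = 0.
  move=> bv; have := curvature_flat b v v x.
  rewrite curvature_diag (curvHH _ v) // linear0r subr0 add0r addrAC subrr sub0r.
  by move/eqP; rewrite oppr_eq0 => /eqP.
have PL v x : B b v = 0 -> curvature b v (p v x) = 0.
  move=> bv; apply: (nondegenerate_inj (euclidean_nondegenerate eB)) => y.
  by rewrite curvature_skew skew LP // linear0r linear0l oppr0 oppr0.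
(* curvature_anticomm polarized at b and h; P h v is zero *)
have PH v h x : B b v = 0 -> B b h = 0 ->
    curvature b v (p h x) = - p h (curvature b v x).
  move=> bv bh; have := curvature_anticomm (b + h) v x.
  rewrite !curvatureDl !(curvHH h v) // !addr0 !linearDl /= curvatureDr.
  by rewrite curvature_anticomm opprD => /addrI.
have PP v x : B b v = 0 ->
    curvature b v (curvature b v x) = curvature b v (p (commutator b v) x).
  move=> bv; rewrite [in LHS]/(curvature b v x) curvatureDr curvatureNr.
  rewrite curvatureDr curvatureNr curvature_anticomm !PL // linear0r.
  by rewrite !(oppr0, addr0).
have P0 v x : B b v = 0 -> curvature b v x = 0.
  move=> bv; apply: (euclidean_eq0 eB); rewrite curvature_skew PP //.
  set h := commutator b v.
  have := PH v h x bv (cH _ _) => e1.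
  have e2 := curvature_skew b v (p h x) x.
  have e3 := skew h (curvature b v x) x.
  have e4 := symmetric_formC B (curvature b v (p h x)) x.
  have e5 := symmetric_formC B (curvature b v x) (p h x).
  move: e2 e3 e4 e5; rewrite e1 !linearNl !linearNr /=; lra.
have Pall v x : curvature b v x = 0.
  have [a [k bk ->]] := decomp v.
  rewrite curvatureN curvatureDl curvatureZl curvature_diag scaler0 add0r.
  by rewrite -curvatureN P0.
move=> u v x; have [a [h bh ->]] := decomp u; have [a' [k bk ->]] := decomp v.
rewrite curvatureDl curvatureZl Pall scaler0 add0r curvatureN curvatureDl.
by rewrite curvatureZl Pall scaler0 add0r curvHH // oppr0.
Qed.

End SkewProducts.

(** * Transporting products and forms along linear maps *)

Section Transfer.
Context {R : realType} {V W : vectType R}.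
Variables (i : {linear W -> V}) (r : {linear V -> W}).
Variables (p : {bilinear V -> V -> V}) (B : {symmetric V}).

Definition transfer_product (x y : W) : W := r (p (i x) (i y)).

Lemma transfer_product_bilinear : bilinear_for *:%R *:%R transfer_product.
Proof.
split=> u a x y; rewrite /transfer_product linearP.
  by rewrite linearDl linearZl_LR linearP.
by rewrite linearDr linearZr_LR linearP.
Qed.

HB.instance Definition _ :=
  bilinear_isBilinear.Build R W W W *:%R *:%R transfer_product
    transfer_product_bilinear.

Definition transfer_form (x y : W) : R := B (i x) (i y).

Lemma transfer_form_bilinear : bilinear_for *%R (idfun \; *%R) transfer_form.
Proof.
split=> u a x y; rewrite /transfer_form linearP.
  by rewrite linearDl linearZl_LR.
by rewrite linearDr linearZr_LR.
Qed.

HB.instance Definition _ :=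
  bilinear_isBilinear.Build R W W R *%R (idfun \; *%R) transfer_form
    transfer_form_bilinear.

Lemma transfer_form_symmetric x y :
  transfer_form x y = (-1) ^+ false * idfun (transfer_form y x).
Proof. by rewrite mul1r /transfer_form symmetric_formC. Qed.

HB.instance Definition _ :=
  isHermitianSesquilinear.Build R W false idfun transfer_form
    transfer_form_symmetric.

End Transfer.

(** * Solvability *)

(** The iterated brackets of shape a complete binary tree of depth [k].  Unlike
    the derived series, which is made of subspaces, their vanishing passes to
    subalgebras and quotients one element at a time. *)
Fixpoint derived_word {V : Type} (c : V -> V -> V) (k : nat) (x : V) : Prop :=
  if k is k'.+1 then
    exists u v, [/\ derived_word c k' u, derived_word c k' v & x = c u v]
  else True.

Section Solvability.
Context {R : realType} {V : vectType R}.

Lemma solvable_words (br : {bilinear V -> V -> V}) : solvable_algebra br ->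
  exists k, forall x, derived_word br k x -> x = 0.
Proof.
case=> k k0; exists k => x.
have : forall x, derived_word br k x -> x \in iter k (derived br) fullv.
  elim: k {k0 x} => [x _|k IHk x [u [v [uw vw ->]]]]; first exact: memvf.
  by rewrite iterS; apply: mem_derived; apply: IHk.
by rewrite k0 => h /h; rewrite memv0 => /eqP.
Qed.

Variables (p : {bilinear V -> V -> V}) (B : {symmetric V}).

(** If nothing but zero were orthogonal to the brackets, then by bilinearity
    nothing but zero would be orthogonal to the iterated brackets of any depth,
    although those of depth [k] are all zero. *)
Lemma orth_commutators_exists k : nondegenerate B -> (exists x : V, x != 0) ->
  (forall x, derived_word (commutator p) k x -> x = 0) ->
  exists2 b, b != 0 & forall u v, B b (commutator p u v) = 0.
Proof.
move=> ndB [x0 x0n] wk; apply: contrapT => none.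
have orth0 b : (forall u v, B b (commutator p u v) = 0) -> b = 0.
  by move=> h; apply: contrapT => /eqP bn; apply: none; exists b.
(* b' lets one argument of the bracket be handled at a time *)
have phi b v : exists b', forall u, B b' u = B b (commutator p u v).
  have lin : scalar (fun u => B b (commutator p u v)).
    by move=> a x y; rewrite /commutator !bilinE /=; ring.
  pose phil := GRing.isLinear.Build _ _ _ _ (fun u => B b (commutator p u v)) lin.
  pose f : {scalar V} := HB.pack (fun u => B b (commutator p u v)) phil.
  exact: (rieszP f ndB).
have span j b : (forall x, derived_word (commutator p) j x -> B b x = 0) -> b = 0.
  elim: j b => [b bw|j IHj b bw].
    by apply: (nondegenerate_inj ndB) => w; rewrite bw // linear0l.
  have half u v : derived_word (commutator p) j v -> B b (commutator p u v) = 0.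
    move=> vw; have [b' b'E] := phi b v.
    rewrite -b'E (IHj b') ?linear0l // => x xw.
    by rewrite b'E; apply: bw; exists x, v.
  apply: orth0 => u v; have [b' b'E] := phi b u.
  rewrite commutatorC linearNr /= -b'E (IHj b') ?linear0l ?oppr0 // => x xw.
  by rewrite b'E commutatorC linearNr /= half // oppr0.
move/eqP: x0n; apply; apply: (span k) => x /wk ->; exact: linear0r.
Qed.
End Solvability.

(** * Euclidean flat solvable Malcev algebras *)

(** Induction on the dimension.  Solvability gives a nonzero [b] orthogonal to
    all brackets, and then right multiplication by [b] vanishes; so the products
    all lie in the hyperplane orthogonal to [b], which inherits every hypothesis
    and has zero curvature by induction. *)
Lemma euclidean_malcev_flat (R : realType) (V : vectType R)
    (p : {bilinear V -> V -> V}) (B : {symmetric V}) k :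
  euclidean B -> skew_product p B -> malcev_flat_product p ->
  (forall x, derived_word (commutator p) k x -> x = 0) ->
  forall u v x, curvature p u v x = 0.
Proof.
have [n] := ubnP (\dim {:V}).
elim: n V p B => // n IHn V p B; rewrite ltnS => dV eB skew flat wk.
have [Vn|V0] := pselect (exists x : V, x != 0); last first.
  move=> u v x; apply: contrapT => /eqP h; apply: V0; by exists (curvature p u v x).
have ndB := euclidean_nondegenerate eB.
have [b bn0 bC] := orth_commutators_exists ndB Vn wk.
have pb := rmul_orth_commutators skew flat eB bC.
apply: (curvature_eq0_codim1 skew flat eB bn0 pb).
pose H := orthov B <[b]>%VS.
have HP u : reflect (B b u = 0) (u \in H).
  by rewrite mem_orthov1 symmetric_formC; apply: eqP.
pose p' : {bilinear subvs_of H -> subvs_of H -> subvs_of H} :=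
  transfer_product (vsval : {linear subvs_of H -> V}) (vsproj H) p.
pose B' : {symmetric subvs_of H} :=
  transfer_form (vsval : {linear subvs_of H -> V}) B.
have B'E x y : B' x y = B (vsval x) (vsval y) by [].
have p'E x y : vsval (p' x y) = p (vsval x) (vsval y).
  rewrite vsprojK //; apply/HP.
  by rewrite symmetric_formC skew pb linear0r oppr0.
have vB (x y : subvs_of H) : vsval (x - y) = vsval x - vsval y by apply: linearB.
have vD (x y : subvs_of H) : vsval (x + y) = vsval x + vsval y by apply: linearD.
have c'E x y : vsval (commutator p' x y) = commutator p (vsval x) (vsval y).
  by rewrite /commutator vB !p'E.
have curv'E x y z :
    vsval (curvature p' x y z) = curvature p (vsval x) (vsval y) (vsval z).
  by rewrite /curvature !vB !p'E c'E.
have : forall u v x, curvature p' u v x = 0.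
  apply: (IHn _ p' B').
  - have bV : b \notin orthov B fullv.
      by apply/mem_orthovPn; exists b; rewrite ?memvf // gt_eqF ?eB.
    have V0 : (0 < \dim {:V})%N.
      by rewrite lt0n dimv_eq0; apply: contra bn0 => /eqP f0; rewrite -memv0 -f0 memvf.
    have dH : \dim H = (\dim {:V}).-1 by rewrite (eq_dim_orthov1 bV) capfv.
    have -> : \dim {:subvs_of H} = \dim H by rewrite dimvf.
    by rewrite dH prednK.
  - move=> u un0; rewrite B'E; apply: eB.
    by apply: contra un0 => /eqP u0; apply/eqP/(can_inj vsvalK); rewrite u0 linear0.
  - by move=> u x y; rewrite !B'E !p'E skew.
  - move=> u v w x; apply: (can_inj vsvalK).
    by rewrite !(vB, vD) !p'E !c'E flat linear0.
  - move=> x xw; apply: (can_inj vsvalK); apply: wk.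
    elim: (k) x xw => [//|j IHj x [u [v [uw vw ->]]]].
    by exists (vsval u), (vsval v); rewrite c'E; split=> //; apply: IHj.
move=> c0 u v w /HP uH /HP vH /HP wH.
by have := congr1 vsval (c0 (vsproj H u) (vsproj H v) (vsproj H w));
  rewrite curv'E !vsprojK // => ->; rewrite linear0.
Qed.

(** * Null vectors of Lorentzian forms *)

Section LorentzianForms.
Context {R : realType} {V : vectType R}.
Variable B : {symmetric V}.

(** What the signature is used for: the hyperplane orthogonal to the basis
    vector of square [-1] is positive definite. *)
Lemma lorentzian_timelike : lorentzian B ->
  exists t, forall x, x != 0 -> B x t = 0 -> 0 < B x x.
Proof.
rewrite /lorentzian; move: (\dim _).-1 => m [X [bX XE]].
exists (tnth X ord0) => x xn0 xt.
pose a j := coord X j x.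
have xE : x = \sum_j a j *: tnth X j.
  rewrite [LHS](coord_basis bX (memvf x)); apply: eq_bigr => j _.
  by rewrite (tnth_nth 0).
have xX j : B x (tnth X j) = a j * (if (j < 1)%N then -1 else 1).
  rewrite [in LHS]xE linear_sumlz (bigD1 j) //= big1 => [|k kj].
    by rewrite addr0 linearZl_LR /= XE eqxx.
  by rewrite linearZl_LR /= XE (negPf kj) mulr0.
have a0 : a ord0 = 0.
  by move: xt; rewrite xX /= mulrN1 => /eqP; rewrite oppr_eq0 => /eqP.
have xx : B x x = \sum_j a j ^+ 2.
  rewrite {2}xE linear_sumr; apply: eq_bigr => j _.
  rewrite linearZr_LR /= xX; case: ltnP => [j1|_]; last by rewrite mulr1 expr2.
  have -> : j = ord0 by apply/val_inj/eqP; rewrite -leqn0.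
  by rewrite a0 !mul0r expr0n.
rewrite lt_def xx sumr_ge0 ?andbT => [|j _]; last exact: sqr_ge0.
apply: contra xn0; rewrite psumr_eq0 => [/allP aj|j _]; last exact: sqr_ge0.
rewrite xE big1 // => j _.
by move: (aj j); rewrite mem_index_enum sqrf_eq0 => /(_ isT)/eqP ->; rewrite scale0r.
Qed.

Variables (t e : V).
Hypotheses (tP : forall x, x != 0 -> B x t = 0 -> 0 < B x x)
  (en0 : e != 0) (ee : B e e = 0).

(** Adding a multiple of [e] to a vector orthogonal to [e] does not change its
    square and moves it into the hyperplane where the form is definite. *)
Lemma null_orth x : B x e = 0 ->
  0 <= B x x /\ (B x x = 0 -> x = (B x t / B e t) *: e).
Proof.
move=> xe.
have et : B e t != 0 by apply/eqP => /(tP en0); rewrite ee ltxx.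
pose y := x - (B x t / B e t) *: e.
have yt : B y t = 0 by rewrite linearBl linearZl_LR /= divfK // subrr.
have yy : B y y = B x x.
  rewrite /y !bilinE /= ee xe [B e x]symmetric_formC xe; ring.
have [y0|/tP/(_ yt)] := eqVneq y 0; last first.
  by rewrite yy => xx; split; [exact: ltW|move=> xx0; move: xx; rewrite xx0 ltxx].
rewrite -yy y0 linear0l; split=> // _.
by apply/eqP; rewrite -subr_eq0 -/y y0.
Qed.

Lemma null_partner : nondegenerate B -> exists2 d, B e d = 1 & B d d = 0.
Proof.
move=> ndB.
have [y ey] : exists y, B e y != 0.
  apply: contrapT => h; case/eqP: en0; apply: (nondegenerate_inj ndB) => w.
  by rewrite linear0l; apply: contrapT => /eqP ew; apply: h; exists w.
have [z ez] : exists z, B e z = 1.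
  by exists ((B e y)^-1 *: y); rewrite linearZr_LR /= mulVf.
exists (z - (B z z / 2) *: e).
  by rewrite linearBr linearZr_LR /= ee mulr0 subr0.
by rewrite !bilinE /= ee [B z e]symmetric_formC ez; field.
Qed.

(** Left multiplication by [e] is here the operator [S] whose vanishing is
    argued above: [S1] and [S2] are flatness at the triples [e, v, e] and
    [u, v, e], the latter evaluated on [e]. *)
Lemma central_null_mul0 (p : {bilinear V -> V -> V}) : nondegenerate B ->
  skew_product p B -> malcev_flat_product p ->
  (forall u, p u e = p e u) -> forall u, p e u = 0.
Proof.
move=> ndB skew flat pe.
have ce u : commutator p e u = 0 by rewrite /commutator pe subrr.
have ce' u : commutator p u e = 0 by rewrite /commutator pe subrr.
have see : p e e = 0.
  apply: (nondegenerate_inj ndB) => w; rewrite linear0l /= skew -pe.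
  have := skew w e e; rewrite [B (p w e) e]symmetric_formC; lra.
have Se x : B (p e x) e = 0 by rewrite skew see linear0r oppr0.
have S1 v x : p v (p e (p e x)) = p e (p v (p e x)).
  have := flat e v e x; rewrite !ce !ce' !linear0l linear0r.
  by rewrite !subr0 add0r => /eqP; rewrite subr_eq0 => /eqP.
have S2 v u : p e (p v (p e u)) = 0.
  have := flat u v e e; rewrite !ce' !linear0l see !linear0r.
  by rewrite !subr0 add0r sub0r pe => /eqP; rewrite oppr_eq0 => /eqP.
have S3 v x : p v (p e (p e x)) = 0 by rewrite S1 S2.
have [[x Sx]|SS0] := pselect (exists x, p e (p e x) != 0).
  have nn : B (p e (p e x)) (p e (p e x)) = 0.
    by rewrite skew S3 linear0r oppr0.
  have [_ /(_ nn) nE] := null_orth (Se (p e x)).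
  move=> u; move: (S3 u x) Sx; rewrite nE linearZr_LR /= pe => /eqP.
  rewrite scaler_eq0; set c := _ / _.
  by case/orP => [/eqP ->|/eqP//]; rewrite scale0r eqxx.
have {}SS0 x : p e (p e x) = 0.
  by apply: contrapT => /eqP h; apply: SS0; exists x.
have SE x : p e x = (B (p e x) t / B e t) *: e.
  have [_] := null_orth (Se x); apply.
  by rewrite skew SS0 linear0r oppr0.
have [d ed dd] := null_partner ndB.
have Sd : p e d = 0.
  have := skew e d d; rewrite [B d _]symmetric_formC => h.
  have : B (p e d) d = 0 by lra.
  by rewrite SE linearZl_LR /= ed mulr1 => ->; rewrite scale0r.
move=> u; have := skew e u d; rewrite Sd linear0r oppr0.
by rewrite SE linearZl_LR /= ed mulr1 => ->; rewrite scale0r.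
Qed.

End LorentzianForms.

(** * The Levi-Civita product of a double extension *)

Section DoubleExtensions.
Context {R : realType} {V : vectType R}.
Variables (br : {bilinear V -> V -> V}) (B : {symmetric V}).
Variables (D xi : 'End(V)) (b0 : V) (lambda : R).

Lemma dext_form_nondegenerate : nondegenerate B ->
  nondegenerate (dext_form B : {symmetric (R^o * V * R^o)%type}).
Proof.
move=> ndB; rewrite /nondegenerate -subv0; apply/subvP => -[[a u] b].
move=> /mem_orthovP h; rewrite memv0.
have := h (0, 0, 1) (memvf _); have := h (1, 0, 0) (memvf _).
rewrite /= !linear0r !mulr0 !mulr1 !add0r !addr0 => -> ->.
have -> // : u = 0.
apply: (nondegenerate_inj ndB) => v; have := h (0, v, 0) (memvf _).
by rewrite /= !mulr0 !add0r linear0l.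
Qed.

(** The Koszul formula fixes both parts of [xi]: the skew-symmetric part is the
    one stored in the bracket, and the symmetric part must be opposite to that
    of [D], that is, [D + xi] must be skew-symmetric. *)
Lemma dext_levi_civita : nondegenerate B ->
  (forall u v, B ((D + xi) u) v = - B u ((D + xi) v)) ->
  forall x y : (R^o * V * R^o)%type,
    levi_civita (dext_bracket br B D xi b0 lambda) (dext_form B) x y
    = dext_product br B D xi b0 lambda x y.
Proof.
move=> ndB skD x y.
apply: (levi_civita_unique (dext_form_nondegenerate ndB)) => z.
case: x y z => [[a u] b] [[a' u'] b'] [[a'' u''] b''] /=.
have xiE v w : B ((xi - adjoint B xi) v) w = B (xi v) w - B v (xi w).
  by rewrite !lfunE /= !lfunE /= linearBl /= adjointP.
have DE v w : B (D v) w = - B v (D w) - B v (xi w) - B (xi v) w.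
  by have := skD v w; rewrite !lfunE /= !linearDl !linearDr /=; lra.
rewrite !xiE !lfunE /= !bilinE /=.
have L := levi_civitaP br ndB u u' u''.
rewrite [B (D u'') u]symmetric_formC [B (D u'') u']symmetric_formC.
rewrite [B (D u') u]symmetric_formC [B (xi u'') u]symmetric_formC.
rewrite [B u'' (xi u)]symmetric_formC !DE.
move: L; lra.
Qed.
End DoubleExtensions.

(** * Levi-Civita products as skew-symmetric torsion-free products *)

Section LeviCivita.
Context {R : realType} {V : vectType R}.
Variables (br : {bilinear V -> V -> V}) (B : {symmetric V}).
Hypothesis ndB : nondegenerate B.

(** The passage from the Koszul formula to the properties from which flat
    products are studied, the bracket becoming the commutator. *)
Lemma levi_civita_product : flat_pseudo_euclidean_malcev br B ->
  exists p : {bilinear V -> V -> V},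
    [/\ skew_product p B, forall u v, commutator p u v = br u v
      & malcev_flat_product p].
Proof.
case=> [[brA _] _ flat].
have lin : bilinear_for *:%R *:%R (levi_civita br B).
  split=> u a x y; apply: levi_civita_unique => // w.
    rewrite linearDl linearZl_LR /= mulrDr mulrCA !levi_civitaP //.
    by rewrite !(linearDr, linearDl, linearZr_LR, linearZl_LR) /=; ring.
  rewrite linearDl linearZl_LR /= mulrDr mulrCA !levi_civitaP //.
  by rewrite !(linearDr, linearDl, linearZr_LR, linearZl_LR) /=; ring.
pose pl := bilinear_isBilinear.Build R V V V *:%R *:%R (levi_civita br B) lin.
pose p : {bilinear V -> V -> V} := HB.pack (levi_civita br B) pl.
have pE u v : levi_civita br B u v = p u v by [].
have pP u v w : 2 * B (p u v) w = B (br u v) w - B (br v w) u + B (br w u) v.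
  by rewrite -pE levi_civitaP.
have pC u v : commutator p u v = br u v.
  apply: (nondegenerate_inj ndB) => w; rewrite linearBl /=.
  have := pP u v w; have := pP v u w.
  rewrite (brA v u) (brA u w) (brA w v) !linearNl /=; lra.
exists p; split=> // [u x y|u v w x].
  have := pP u x y; have := pP u y x; rewrite (symmetric_formC B x).
  rewrite (brA y x) (brA y u) (brA x u) !linearNl /=; lra.
have := congr1 (fun f : 'End(V) => f x) (flat u v w).
by rewrite /malcev_curvature !(add_lfunE, opp_lfunE, comp_lfunE, lmulE) // lfunE !pC.
Qed.

Variable p : {bilinear V -> V -> V}.
Hypotheses (skew : skew_product p B) (pC : forall u v, commutator p u v = br u v).

(** Uniqueness of the Levi-Civita product: it is the only metric torsion-free
    product. *)
Lemma levi_civita_skew_product u v : levi_civita br B u v = p u v.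
Proof.
apply: levi_civita_unique => // w; rewrite -!pC /commutator !linearBl /=.
have := skew u v w; have := skew v w u; have := skew w u v.
have := skew v u w; have := skew w v u; have := skew u w v.
rewrite ![B v _]symmetric_formC ![B u _]symmetric_formC ![B w _]symmetric_formC.
lra.
Qed.

Lemma curvature0_lie_flat :
  (forall u v x, curvature p u v x = 0) -> lie_flat br B.
Proof.
move=> c0 u v; apply/lfunP => x; rewrite /lie_curvature.
rewrite !(add_lfunE, opp_lfunE, comp_lfunE, lmulE) // lfunE.
rewrite !levi_civita_skew_product -pC.
by rewrite -[RHS](c0 u v x) /curvature.
Qed.

(** First Bianchi identity: the jacobiator is the cyclic sum of [P u v w]. *)
Lemma curvature0_lie_algebra :
  (forall u v x, curvature p u v x = 0) -> lie_algebra br.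
Proof.
move=> c0; split=> [u v|u v w]; rewrite /jacobiator -!pC; first exact: commutatorC.
have pc a b x : p (commutator p a b) x = p a (p b x) - p b (p a x).
  by apply/eqP; rewrite -subr_eq0; apply/eqP; exact: c0.
have cc a b x : commutator p (commutator p a b) x
    = p a (p b x) - p b (p a x) - (p x (p a b) - p x (p b a)).
  by rewrite {1}/commutator pc /commutator linearBr.
by rewrite !cc; vect_ring.
Qed.

Lemma flat_pseudo_euclidean_malcev_product : malcev_flat_product p ->
  lie_algebra br -> flat_pseudo_euclidean_malcev br B.
Proof.
move=> flat [brA J0]; split=> //.
  by split=> // u v w; rewrite !J0 linear0l.
move=> u v w; apply/lfunP => x.
rewrite /malcev_curvature !(add_lfunE, opp_lfunE, comp_lfunE, lmulE) // lfunE.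
by rewrite !levi_civita_skew_product -!pC; apply: flat.
Qed.
End LeviCivita.

(** * Reduction along a null vector *)

Section NullReduction.
Context {R : realType} {V : vectType R}.
Variables (p : {bilinear V -> V -> V}) (B : {symmetric V}) (e d : V).
Hypotheses (skew : skew_product p B).
Hypotheses (ee : B e e = 0) (ed : B e d = 1) (dd : B d d = 0).
Hypotheses (pe : forall u, p e u = 0) (pe' : forall u, p u e = 0).

(** A model of the quotient of the orthogonal of [e] by [e]: a complement of
    [e] there, obtained from the choice of [d]. *)
Definition screen : {vspace V} := (orthov B <[e]> :&: orthov B <[d]>)%VS.

Lemma screenP x : reflect (B x e = 0 /\ B x d = 0) (x \in screen).
Proof.
rewrite memv_cap !mem_orthov1.
by apply: (iffP andP) => [[/eqP ? /eqP ?]|[-> ->]].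
Qed.

Definition screen_part (x : V) : V := x - B x d *: e - B x e *: d.

Lemma screen_part_linear : linear screen_part.
Proof.
move=> a x y; rewrite /screen_part !linearDl !linearZl_LR /=.
by apply: coordinate_inj => i; rewrite !coordinateE; ring.
Qed.

HB.instance Definition _ :=
  GRing.isLinear.Build R V V *:%R screen_part screen_part_linear.

Lemma screen_part_mem x : screen_part x \in screen.
Proof.
apply/screenP; rewrite /screen_part !bilinE /= ee dd ed [B d e]symmetric_formC ed.
by split; ring.
Qed.

Lemma screen_part_id x : x \in screen -> screen_part x = x.
Proof.
by case/screenP => xe xd; rewrite /screen_part xe xd !scale0r !subr0.
Qed.

Lemma screen_part_form x y : y \in screen -> B (screen_part x) y = B x y.
Proof.
case/screenP => ye yd; rewrite /screen_part !bilinE /=.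
by rewrite ![B _ y]symmetric_formC [B y e]ye [B y d]yd; ring.
Qed.

Lemma product_orth u v : B (p u v) e = 0.
Proof. by rewrite skew pe' linear0r oppr0. Qed.

Lemma commutator_orth u v : B (commutator p u v) e = 0.
Proof. by rewrite linearBl /= !product_orth subrr. Qed.

(** Products are not affected by the [e]-component of a factor, so that
    projecting after each of several nested products amounts to projecting
    once; this is why identities pass to the screen. *)
Lemma product_screen_partl u v : B u e = 0 -> p (screen_part u) v = p u v.
Proof.
move=> ue; rewrite /screen_part ue scale0r subr0 linearBl linearZl_LR /= pe.
by rewrite scaler0 subr0.
Qed.

Lemma product_screen_partr u v : B v e = 0 -> p u (screen_part v) = p u v.
Proof.
move=> ve; rewrite /screen_part ve scale0r subr0 linearBr linearZr_LR /= pe'.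
by rewrite scaler0 subr0.
Qed.

Definition to_screen : {linear V -> subvs_of screen} := vsproj screen \o screen_part.

Lemma to_screenE x : vsval (to_screen x) = screen_part x.
Proof. exact: vsprojK (screen_part_mem x). Qed.

Let incl : {linear subvs_of screen -> V} := vsval.

Definition screen_product :
    {bilinear subvs_of screen -> subvs_of screen -> subvs_of screen} :=
  transfer_product incl to_screen p.

Definition screen_form : {symmetric subvs_of screen} := transfer_form incl B.

Lemma screen_productE x y :
  vsval (screen_product x y) = screen_part (p (vsval x) (vsval y)).
Proof. exact: to_screenE. Qed.

Lemma screen_formE x y : screen_form x y = B (vsval x) (vsval y).
Proof. by []. Qed.

Lemma screen_part_vsval (x : subvs_of screen) : screen_part (vsval x) = vsval x.
Proof. exact/screen_part_id/subvsP. Qed.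

Lemma screen_commutatorE x y :
  vsval (commutator screen_product x y)
    = screen_part (commutator p (vsval x) (vsval y)).
Proof.
have vB (y' z : subvs_of screen) : vsval (y' - z) = vsval y' - vsval z.
  by apply: linearB.
by rewrite /commutator vB !screen_productE; apply/esym/(linearB screen_part).
Qed.

Lemma screen_product_skew : skew_product screen_product screen_form.
Proof.
move=> u x y; rewrite !screen_formE !screen_productE.
rewrite [in RHS]symmetric_formC !screen_part_form ?subvsP // skew.
by rewrite [in RHS]symmetric_formC.
Qed.

Lemma screen_product_flat :
  malcev_flat_product p -> malcev_flat_product screen_product.
Proof.
move=> flat u v w x; apply: (can_inj vsvalK).
have vB (y z : subvs_of screen) : vsval (y - z) = vsval y - vsval z by apply: linearB.
have vD (y z : subvs_of screen) : vsval (y + z) = vsval y + vsval z by apply: linearD.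
have cl a b z : commutator p (screen_part (commutator p a b)) z =
    commutator p (commutator p a b) z.
  by rewrite {1}/commutator product_screen_partl ?product_screen_partr ?commutator_orth.
rewrite !(vB, vD) !screen_productE !screen_commutatorE.
rewrite !cl !product_screen_partl ?commutator_orth //.
rewrite !product_screen_partr ?product_orth //.
rewrite -!linearB -linearD -linearB /=.
by rewrite flat !linear0.
Qed.

(** The iterated brackets of the screen are projections of iterated brackets of
    the whole algebra; orthogonality to [e] is what the induction needs in order
    to drop the inner projections. *)
Lemma screen_derived_word k x : derived_word (commutator screen_product) k x ->
  exists z, [/\ derived_word (commutator p) k z, vsval x = screen_part z &
    B z e = 0].
Proof.
elim: k x => [x _|k IHk x [u [v [/IHk [z [zw uz ze]] /IHk [y [yw vy ye]] ->]]]].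
  exists (vsval x); split; rewrite ?screen_part_vsval //.
  by have /screenP[] := subvsP x.
exists (commutator p z y); split; [by exists z, y| |exact: commutator_orth].
rewrite screen_commutatorE uz vy /commutator.
by rewrite !product_screen_partl // !product_screen_partr.
Qed.

Lemma screen_form_euclidean :
  (forall x, B x e = 0 -> 0 <= B x x /\ (B x x = 0 -> exists c, x = c *: e)) ->
  euclidean screen_form.
Proof.
move=> pos u un0; rewrite screen_formE.
have /screenP[ue ud] := subvsP u; have [u_ge0 uE] := pos _ ue.
rewrite lt_def u_ge0 andbT; apply: contra un0 => /eqP /uE [c uc].
apply/eqP/(can_inj vsvalK); rewrite linear0 uc.
by move: ud; rewrite uc linearZl_LR /= ed mulr1 => ->; rewrite scale0r.
Qed.

End NullReduction.

(** * Recovering the algebra as a double extension *)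

Section NullDoubleExtension.
Context {R : realType} {V : vectType R}.
Variables (br p : {bilinear V -> V -> V}) (B : {symmetric V}) (e d : V).
Hypotheses (skew : skew_product p B) (pC : forall u v, commutator p u v = br u v).
Hypotheses (ee : B e e = 0) (ed : B e d = 1) (dd : B d d = 0).
Hypotheses (pe : forall u, p e u = 0) (pe' : forall u, p u e = 0).

Local Notation W := (subvs_of (screen B e d)).
Local Notation Wp := (screen_product p B e d).
Local Notation WB := (screen_form B e d).

Definition screen_bracket : {bilinear W -> W -> W} :=
  transfer_product (vsval : {linear W -> V}) (to_screen B e d) br.

Lemma screen_bracketE x y :
  vsval (screen_bracket x y) = screen_part B e d (br (vsval x) (vsval y)).
Proof. exact: (to_screenE ee ed dd). Qed.

Lemma screen_product_commutator x y : commutator Wp x y = screen_bracket x y.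
Proof.
by apply: (can_inj vsvalK); rewrite screen_commutatorE // screen_bracketE pC.
Qed.

Definition screen_D : 'End(W) :=
  linfun (to_screen B e d \o br d \o (vsval : {linear W -> V})).

Definition screen_xi : 'End(W) :=
  linfun (to_screen B e d \o applyr p d \o (vsval : {linear W -> V})).

Definition screen_b0 : W := - to_screen B e d (p d d).

Lemma screen_DE u : screen_D u = to_screen B e d (br d (vsval u)).
Proof. by rewrite lfunE. Qed.

Lemma screen_xiE u : screen_xi u = to_screen B e d (p (vsval u) d).
Proof. by rewrite lfunE. Qed.

Lemma to_screen_form x y : WB (to_screen B e d x) y = B x (vsval y).
Proof. by rewrite screen_formE to_screenE // screen_part_form ?subvsP. Qed.

(** [D + xi] is the screen part of [L_d]. *)
Lemma screen_D_xi_skew u v :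
  WB ((screen_D + screen_xi) u) v = - WB u ((screen_D + screen_xi) v).
Proof.
rewrite add_lfunE [in RHS]add_lfunE !screen_DE !screen_xiE.
have DxiE x : to_screen B e d (br d x) + to_screen B e d (p x d)
    = to_screen B e d (p d x).
  by rewrite -linearD -pC /commutator subrK.
by rewrite !DxiE [in RHS]symmetric_formC !to_screen_form skew symmetric_formC.
Qed.

Lemma br_e x : br e x = 0.
Proof. by rewrite -pC /commutator pe pe' subrr. Qed.

Lemma br_e' x : br x e = 0.
Proof. by rewrite -pC /commutator pe pe' subrr. Qed.

Lemma br_dd : br d d = 0. Proof. by rewrite -pC commutatorxx. Qed.

Lemma screen_decomp x : x = B x e *: d + screen_part B e d x + B x d *: e.
Proof. by apply: coordinate_inj => i; rewrite /screen_part !coordinateE; ring. Qed.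

Definition to_dext (x : V) : (R^o * W * R^o)%type := (B x e, to_screen B e d x, B x d).

Lemma to_dext_linear : linear to_dext.
Proof.
move=> a x y; congr (_, _, _); rewrite ?linearP //.
  by rewrite linearDl linearZl_LR.
by rewrite linearDl linearZl_LR.
Qed.

HB.instance Definition _ :=
  GRing.isLinear.Build R V (R^o * W * R^o)%type *:%R to_dext to_dext_linear.

Lemma to_dext_bijective : bijective to_dext.
Proof.
exists (fun z : R^o * W * R^o => z.1.1 *: d + vsval z.1.2 + z.2 *: e).
  by move=> x; rewrite /= to_screenE // -screen_decomp.
case=> -[a u] b /=; have /screenP[ue ud] := subvsP u.
have xe : B (a *: d + vsval u + b *: e) e = a.
  by rewrite !bilinE /= ee [B d e]symmetric_formC ed ue; ring.
have xd : B (a *: d + vsval u + b *: e) d = b.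
  by rewrite !bilinE /= dd ed ud; ring.
rewrite /to_dext xe xd; congr (_, _, _).
apply: (can_inj vsvalK); rewrite to_screenE //.
rewrite /screen_part xe xd; apply: coordinate_inj => i; rewrite !coordinateE; ring.
Qed.

Lemma to_dext_form x y : dext_form WB (to_dext x) (to_dext y) = B x y.
Proof.
rewrite /= to_screen_form to_screenE // /screen_part !bilinE /=.
by ring.
Qed.

(** The [e]-component compares [B [u, v] d] with the skew part of [xi]: both
    equal [B (u * v - v * u) d] up to sign, by skew-symmetry of the product. *)
Lemma to_dext_bracket x y : nondegenerate WB ->
  to_dext (br x y) =
    dext_bracket screen_bracket WB screen_D screen_xi screen_b0 0
      (to_dext x) (to_dext y).
Proof.
move=> ndW; rewrite /= /to_dext.
set u := to_screen B e d x; set v := to_screen B e d y.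
have brE : br x y = B x e *: br d (vsval v) - B y e *: br d (vsval u)
    + br (vsval u) (vsval v).
  have brC : br (vsval u) d = - br d (vsval u) by rewrite -!pC commutatorC.
  rewrite {1}(screen_decomp x) {1}(screen_decomp y) -!to_screenE // -/u -/v.
  rewrite !bilinE /= !br_e !br_e' br_dd brC.
  by apply: coordinate_inj => i; rewrite !coordinateE; ring.
congr (_, _, _).
- by rewrite -pC commutator_orth.
- rewrite brE !screen_DE linearD linearB !linearZ /=.
  by congr (_ + _).
- have b0E w : WB screen_b0 w = B (br d (vsval w)) d.
    rewrite linearNl /= to_screen_form -pC linearBl /= skew.
    have := skew (vsval w) d d; rewrite [B (p _ d) d]symmetric_formC => h.
    rewrite (symmetric_formC B d); lra.
  have xiE : WB ((screen_xi - adjoint WB screen_xi) u) v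
      = - B (br (vsval u) (vsval v)) d.
    rewrite add_lfunE opp_lfunE linearBl /= adjointP // !screen_xiE.
    rewrite (symmetric_formC WB u) !to_screen_form !skew -pC linearBl /=.
    rewrite !(symmetric_formC B d); lra.
  rewrite !b0E xiE brE !bilinE /=; ring.
Qed.

Lemma to_dext_isometry : nondegenerate WB ->
  isometrically_isomorphic br B
    (dext_bracket screen_bracket WB screen_D screen_xi screen_b0 0)
    (dext_form WB).
Proof.
move=> ndW; exists to_dext; split; first exact: to_dext_bijective.
  by move=> u v; exact: to_dext_bracket.
exact: to_dext_form.
Qed.

End NullDoubleExtension.

Theorem corollary4p4 (R : realType) (M : vectType R)
    (br : {bilinear M -> M -> M}) (B : {symmetric M}) :
  flat_pseudo_euclidean_malcev br B ->
  lorentzian B ->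
  solvable_algebra br ->
  degenerate_center br B ->
  exists (Mbar : vectType R) (brbar : {bilinear Mbar -> Mbar -> Mbar})
    (Bbar : {symmetric Mbar}) (D xi : 'End(Mbar)) (b0 : Mbar),
    [/\ lie_algebra brbar, euclidean Bbar, lie_flat brbar Bbar &
        flat_double_extension brbar Bbar D xi b0 0 br B].
Proof.
move=> flatM lorB /solvable_words [k wk] degZ.
have [_ ndB _] := flatM.
have [t tP] := lorentzian_timelike lorB.
have [p [skew pC flat]] := levi_civita_product ndB flatM.
pose e := vpick (center br :&: orthov B (center br))%VS.
have en0 : e != 0 by rewrite vpick0.
have /memv_capP[eZ eZo] : e \in (center br :&: orthov B (center br))%VS.
  exact: memv_pick.
have ee : B e e = 0 by move/mem_orthovP: eZo; apply.
have peC u : p u e = p e u.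
  apply/esym/eqP; rewrite -subr_eq0; apply/eqP.
  by move/centerP: eZ => eZ; exact: etrans (pC e u) (eZ u).
have pe := central_null_mul0 tP en0 ee ndB skew flat peC.
have pe' u : p u e = 0 by rewrite peC pe.
have [d ed dd] := null_partner en0 ee ndB.
have eW : euclidean (screen_form B e d).
  apply: screen_form_euclidean => // x xe.
  have [xx xE] := null_orth tP en0 ee xe; split=> // /xE; by exists (B x t / B e t).
have ndW := euclidean_nondegenerate eW.
have skewW := screen_product_skew skew ee ed dd.
have flatW := screen_product_flat skew ee ed dd pe pe' flat.
have pCW := screen_product_commutator pC ee ed dd.
have curvW : forall u v x, curvature (screen_product p B e d) u v x = 0.
  apply: (euclidean_malcev_flat (k := k) eW skewW flatW) => x.
  move=> /(screen_derived_word skew ee ed dd pe pe') [z [zw xz _]].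
  apply: (can_inj vsvalK); rewrite xz (wk z) ?linear0 //.
  suff -> : (br : M -> M -> M) = commutator p by [].
  by apply/funext => a; apply/funext => b; rewrite pC.
have lieW := curvature0_lie_algebra pCW curvW.
exists (subvs_of (screen B e d)), (screen_bracket br B e d), (screen_form B e d),
  (screen_D br B e d), (screen_xi p B e d), (screen_b0 p B e d).
split=> //; first exact: (curvature0_lie_flat ndW skewW pCW curvW).
split=> //.
- exact: (flat_pseudo_euclidean_malcev_product ndW skewW pCW flatW lieW).
- exact: (to_dext_isometry skew pC ee ed dd pe pe' ndW).
- by apply: dext_levi_civita => //; apply: screen_D_xi_skew.
Qed.
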